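(* For each integer $a$, the language $L_a = \{ (n)_2 : n \geq 0,\ s(n) = a \}$ over the alphabet $\{0,1\}$ is context-free but not regular.
   Context: The infinity series $(s(n))_{n \geq 0}$ is the integer sequence defined by $s(0)=0$, $s(2n) = -s(n)$ for $n \geq 1$, and $s(2n+1) = s(n)+1$ for $n \geq 0$. For $n \geq 0$, $(n)_2$ denotes the binary representation of $n$ without leading zeros (most significant digit first), with $(0)_2$ the empty string. *)

(* Defs.v *)
From Stdlib Require Import Relation_Operators.
From mathcomp Require Import all_boot all_order all_algebra.

Set Implicit Arguments.
Unset Strict Implicit.
Unset Printing Implicit Defensive.

Import GRing.Theory.
Local Open Scope ring_scope.

(* The first argument is fuel: since n./2 < n for n > 0, fuel n suffices to   *)
(* reach 0. The defining recurrences are infser0, infser_double and           *)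
(* infser_doubleS below.                                                      *)
Fixpoint infser_rec (k n : nat) : int :=
  if k isn't k'.+1 then 0 else
  if n == 0%N then 0 else
  if odd n then infser_rec k' n./2 + 1 else - infser_rec k' n./2.

Definition infser (n : nat) : int := infser_rec n n.

(* Most significant digit first, true standing for the digit 1; fuel as in    *)
(* infser_rec. The defining equations are binrep0 and binrepE below.          *)
Fixpoint binrep_rec (k n : nat) : seq bool :=
  if k isn't k'.+1 then [::] else
  if n == 0%N then [::] else rcons (binrep_rec k' n./2) (odd n).

Definition binrep (n : nat) : seq bool := binrep_rec n n.

Lemma half_leq (k n : nat) : (n.+1 <= k.+1 -> n.+1./2 <= k)%N.
Proof.
rewrite ltnS; apply: leq_trans.
by rewrite /= leq_uphalf_double -addnn leq_addr.
Qed.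

Lemma infser_recE (k n : nat) : (n <= k)%N -> infser_rec k n = infser n.
Proof.
suff fuelE l m : (m <= k)%N -> (m <= l)%N ->
    infser_rec k m = infser_rec l m by move=> le_nk; apply: fuelE.
elim: k l m => [|k IHk] [|l] [|m] // le_mk le_ml.
by rewrite /= (IHk l) //; apply: half_leq.
Qed.

Lemma infser0 : infser 0 = 0.
Proof. by []. Qed.

Lemma infserE (n : nat) : (0 < n)%N ->
  infser n = if odd n then infser n./2 + 1 else - infser n./2.
Proof.
by case: n => // n _; rewrite -(@infser_recE n n.+1./2) //; apply: half_leq.
Qed.

Lemma infser_double (n : nat) : (1 <= n)%N -> infser (2 * n) = - infser n.
Proof.
by move=> n_gt0; rewrite infserE ?muln_gt0 // mul2n odd_double doubleK.
Qed.

Lemma infser_doubleS (n : nat) : infser (2 * n + 1) = infser n + 1.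
Proof.
by rewrite mul2n addn1 infserE // oddS odd_double /= uphalf_double.
Qed.

Lemma binrep_recE (k n : nat) : (n <= k)%N -> binrep_rec k n = binrep n.
Proof.
suff fuelE l m : (m <= k)%N -> (m <= l)%N ->
    binrep_rec k m = binrep_rec l m by move=> le_nk; apply: fuelE.
elim: k l m => [|k IHk] [|l] [|m] // le_mk le_ml.
by rewrite /= (IHk l) //; apply: half_leq.
Qed.

Lemma binrep0 : binrep 0 = [::].
Proof. by []. Qed.

Lemma binrepE (n : nat) : (0 < n)%N -> binrep n = rcons (binrep n./2) (odd n).
Proof.
by case: n => // n _; rewrite -(@binrep_recE n n.+1./2) //; apply: half_leq.
Qed.

Definition language (A : Type) := seq A -> Prop.

Record dfa (A : finType) := Dfa {
  dfa_state : finType;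
  dfa_start : dfa_state;
  dfa_final : {set dfa_state};
  dfa_trans : dfa_state -> A -> dfa_state
}.

Definition dfa_lang (A : finType) (M : dfa A) : language A :=
  fun w => foldl (@dfa_trans A M) (dfa_start M) w \in dfa_final M.

Definition regular (A : finType) (L : language A) : Prop :=
  exists M : dfa A, forall w, L w <-> dfa_lang M w.

(* Sentential forms are words over cfg_nonterm + A; being a sum, nonterminals *)
(* and terminals are disjoint. A rule (X, u) is the production X -> u.        *)
Record cfg (A : finType) := Cfg {
  cfg_nonterm : finType;
  cfg_start : cfg_nonterm;
  cfg_rules : seq (cfg_nonterm * seq (cfg_nonterm + A))
}.

Definition cfg_step (A : finType) (G : cfg A)
    (x y : seq (cfg_nonterm G + A)) : Prop :=
  exists (l r u : seq (cfg_nonterm G + A)) (X : cfg_nonterm G),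
    [/\ (X, u) \in cfg_rules G, x = l ++ inl X :: r & y = l ++ u ++ r].

Definition cfg_lang (A : finType) (G : cfg A) : language A :=
  fun w => clos_refl_trans _ (@cfg_step A G)
             [:: inl (cfg_start G)] [seq inr c | c <- w].

Definition context_free (A : finType) (L : language A) : Prop :=
  exists G : cfg A, forall w, L w <-> cfg_lang G w.

Definition infser_level (a : int) : language bool :=
  fun w => exists n : nat, infser n = a /\ w = binrep n.

(* Main.v *)
From Stdlib Require Import Relation_Operators.
Require Import Defs.
From mathcomp Require Import all_boot all_order all_algebra.
From mathcomp Require Import zify.

(** Reading digits from the left, the digits 1 and 0 act on the integers by
    [x -> x + 1] and [x -> - x]; hence [s(n)] is the sum, over the digits 1 of
    [(n)_2], of the sign [(-1)^j] where [j] is the number of zeros to the right.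
    Over the suffixes of a word, from the shortest to the longest, this sum is
    a walk on the integers with steps in [{-1, 0, 1}]. Let [Z_e] be the set of
    words of level 0 whose number of zeros has parity [e]. Cutting walks at
    their last visit to 0 gives the productions [Z_0 -> empty],
    [Z_e -> 0 Z_(1-e)] and [Z_e -> 1 Z_1 1 Z_(1-e)], and shows that a word of
    level [k >= 0] (resp. [- k - 1 < 0]) is a word of level 0 followed by a word
    of [(1 Z_0)^k] (resp. [(1 Z_0)^k 1 Z_1]).
    Non-regularity: if a finite automaton confuses [1^i] and [1^j], then it
    confuses [1^i v] and [1^j v] for a word [v] with an even number of zeros
    that brings the former to level [a]; the latter has level [a + j - i]. *)

Set Implicit Arguments.
Unset Strict Implicit.
Unset Printing Implicit Defensive.

Import Order.TTheory GRing.Theory.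
Local Open Scope ring_scope.

(** * Derivations in a context-free grammar and their soundness *)

Section ContextFreeGrammars.

Variables (A : finType) (G : cfg A).
Local Notation form := (seq (cfg_nonterm G + A)).
Implicit Types (x y z : form) (w : seq A).

Definition derives : form -> form -> Prop := clos_refl_trans _ (@cfg_step A G).

Lemma derives_rule X u : (X, u) \in cfg_rules G -> derives [:: inl X] u.
Proof.
by move=> Xu; apply: rt_step; exists [::], [::], u, X; rewrite cats0.
Qed.

Lemma derives_trans y x z : derives x y -> derives y z -> derives x z.
Proof. exact: rt_trans. Qed.

Lemma derives_rule_trans X u x :
  (X, u) \in cfg_rules G -> derives u x -> derives [:: inl X] x.
Proof. by move/derives_rule; exact: derives_trans. Qed.

Lemma derives_ctx l r x y : derives x y -> derives (l ++ x ++ r) (l ++ y ++ r).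
Proof.
elim=> {x y} [x y|x|x y z _ IHxy _]; last exact: rt_trans.
  move=> [l' [r' [u [X [Xu -> ->]]]]]; apply: rt_step.
  by exists (l ++ l'), (r' ++ r), u, X; rewrite -!catA.
exact: rt_refl.
Qed.

Lemma derives_cat x x' y y' :
  derives x y -> derives x' y' -> derives (x ++ x') (y ++ y').
Proof.
move=> xy xy'; apply: (derives_trans (y := y ++ x')).
  exact: (derives_ctx [::]).
by have := derives_ctx y [::] xy'; rewrite !cats0.
Qed.

Lemma derives_cons s x y : derives x y -> derives (s :: x) (s :: y).
Proof. by move=> xy; have := derives_ctx [:: s] [::] xy; rewrite !cats0. Qed.

Variable I : cfg_nonterm G -> language A.

(** Sentential forms are read as languages, with [I X] a candidate language for each nonterminal
    [X]. *)
Fixpoint form_lang (x : form) : language A :=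
  match x with
  | [::] => fun w => w = [::]
  | inr c :: x' => fun w => exists2 w', w = c :: w' & form_lang x' w'
  | inl X :: x' =>
      fun w => exists u v, [/\ w = u ++ v, I X u & form_lang x' v]
  end.

Lemma form_lang_cat x y w :
  form_lang (x ++ y) w <->
  exists u v, [/\ w = u ++ v, form_lang x u & form_lang y v].
Proof.
split.
  elim: x w => [|[X|c] x IHx] w /=.
  - by exists [::], w.
  - move=> [u [v [-> Xu /IHx[u' [v' [-> xu' yv']]]]]].
    by exists (u ++ u'), v'; rewrite catA; split=> //; exists u, u'.
  - move=> [w' -> /IHx[u [v [-> xu yv]]]].
    by exists (c :: u), v; split=> //; exists u.
move=> [u [v [-> + yv]]].
elim: x u => [|[X|c] x IHx] u /=; first by move->.
  move=> [u1 [u2 [-> Xu1 xu2]]]; exists u1, (u2 ++ v).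
  by rewrite catA; split=> //; apply: IHx.
by move=> [u' -> xu']; exists (u' ++ v); rewrite ?cat_cons //; apply: IHx.
Qed.

Lemma form_lang_word w : form_lang [seq inr c | c <- w] w.
Proof. by elim: w => //= c w IHw; exists w. Qed.

(** Derivations are read backwards: since [I] is closed under the productions, a step from [x] to
    [y] makes the language of [y] a part of that of [x]. *)
Lemma cfg_lang_sound :
    (forall X u, (X, u) \in cfg_rules G -> forall w, form_lang u w -> I X w) ->
  forall w, cfg_lang G w -> I (cfg_start G) w.
Proof.
move=> rule_sound w.
have derives_sound x y : derives x y -> forall v, form_lang y v -> form_lang x v.
  elim=> {x y} // [x y|x y z _ IHxy _ IHyz v /IHyz/IHxy//].
  move=> [l [r [u [X [Xu -> ->]]]]] v.
  move=> /form_lang_cat[v1 [v2 [-> lv1 /form_lang_cat[v3 [v4 [-> uv3 rv4]]]]]].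
  apply/form_lang_cat; exists v1, (v3 ++ v4); split=> //.
  by exists v3, v4; split=> //; apply: rule_sound Xu _ uv3.
move=> /derives_sound/(_ _ (form_lang_word w))[u [v [-> Su ->]]].
by rewrite cats0.
Qed.

End ContextFreeGrammars.

(** * Levels of binary words *)

Definition parity (w : seq bool) : bool := odd (count negb w).

Fixpoint level (w : seq bool) : int :=
  if w is b :: w' then level w' + (if b then (-1) ^+ parity w' else 0) else 0.

Lemma parity_cons b w : parity (b :: w) = ~~ b (+) parity w.
Proof. by rewrite /parity /= oddD oddb. Qed.

Lemma parity_cat u v : parity (u ++ v) = parity u (+) parity v.
Proof. by rewrite /parity count_cat oddD. Qed.

(** Each zero of [v] negates the contribution of [u]. *)
Lemma level_cat u v : level (u ++ v) = (-1) ^+ parity v * level u + level v.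
Proof.
elim: u => [|b u IHu] /=; first by rewrite mulr0 add0r.
rewrite IHu parity_cat signr_addb; case: b; last by rewrite !addr0.
by rewrite mulrDr addrAC [(-1) ^+ parity u * _]mulrC.
Qed.

Lemma level_rcons w b : level (rcons w b) = if b then level w + 1 else - level w.
Proof. by rewrite -cats1 level_cat; case: b => /=; lia. Qed.

Lemma level_binrep n : level (binrep n) = infser n.
Proof.
have [m] := ubnP n; elim: m n => // m IHm [|n] // lt_nm.
rewrite binrepE // infserE // level_rcons IHm //; lia.
Qed.

Lemma head_binrep n : head true (binrep n).
Proof.
have [m] := ubnP n; elim: m n => // m IHm [|[|n]] // lt_nm.
rewrite binrepE //; have /IHm : (n.+2./2 < m)%N by lia.
by rewrite (binrepE (n := n.+2./2)) //; case: (binrep _).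
Qed.

Lemma binrep_surj w : head true w -> exists n, w = binrep n.
Proof.
elim/last_ind: w => [|w b IHw]; first by exists 0%N.
case: w IHw => [|c w] IHw; first by case: b => // _; exists 1%N.
rewrite rcons_cons /= => c1; have [n wn] := IHw c1.
exists (b + n.*2)%N; rewrite -rcons_cons binrepE; last first.
  by case: n wn => // n _; rewrite doubleS !addnS.
by rewrite half_bit_double oddD odd_double addbF oddb wn.
Qed.

Lemma infser_levelE a w : infser_level a w <-> head true w /\ level w = a.
Proof.
split=> [[n [<- ->]]|[/binrep_surj[n ->] <-]].
  by rewrite level_binrep head_binrep.
by exists n; rewrite level_binrep.
Qed.

(* The cut is at the longest suffix of level 0. *)
Lemma level_split w : level w != 0 ->
  exists u z, [/\ w = u ++ true :: z, level z = 0,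
    parity z = (level w < 0) & level u = `|level w| - 1].
Proof.
move=> w_neq0.
suff [u [z [wE z0 pz]]] : exists u z,
    [/\ w = u ++ true :: z, level z = 0 & parity z = (level w < 0)].
  exists u, z; split=> //; move: pz; rewrite wE level_cat /= z0 parity_cons /=.
  by case: (parity z) => /=; lia.
elim: w w_neq0 => //= b w IHw bw_neq0.
(* If the tail has level 0, the first digit is the 1 that leaves 0. Otherwise both levels are
   nonzero and have the same sign, since steps have size at most 1. *)
have [w0|/[dup] w_neq0 /IHw[u [z [wE z0 pz]]]] := eqVneq (level w) 0.
  exists [::], w; split=> //; move: bw_neq0; rewrite w0; case: b => //.
  by case: (parity w).
exists (b :: u), z; split=> //; first by rewrite wE.
by rewrite pz; move: bw_neq0; case: b => /=; case: (parity w) => /=; lia.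
Qed.

(** The leading 1 returns to 0 from level 1 or -1, and the cut is at the last departure from 0.
    These two steps have opposite signs, so the number of zeros between them is odd. *)
Lemma level0_split w : level (true :: w) = 0 ->
  exists u z, [/\ w = u ++ true :: z, level u = 0, parity u = true &
    level z = 0].
Proof.
move=> /= w0; have [|u [z [wE z0 pz lu]]] := @level_split w.
  by move: w0; case: (parity w) => /=; lia.
exists u, z; split=> //; first by move: w0 lu; case: (parity w) => /=; lia.
have : parity w = parity u (+) (level w < 0).
  by rewrite {1}wE parity_cat parity_cons pz.
by move: w0; case: (parity w); case: (parity u); case: ltP => //=; lia.
Qed.

(** * The grammar of a level *)

Definition climb k : seq (option bool + bool) :=
  iter k (cat^~ [:: inr true; inl (Some false)]) [::].

Definition tail (a : int) : seq (option bool + bool) :=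
  match a with
  | Posz k => climb k
  | Negz k => climb k ++ [:: inr true; inl (Some true)]
  end.

(* [Some e] generates the words of level 0 with parity [e], and [None] those of
   level [a] without leading zeros: a nonempty prefix of level 0 without leading
   zeros is derived by a production of [Some false] or [Some true]. *)
Definition level_rules (a : int) : seq (option bool * seq (option bool + bool)) :=
  [:: (Some false, [::]), (None, tail a) & flatten
    [seq [:: (Some e, [:: inr false; inl (Some (~~ e))]);
             (Some e, [:: inr true; inl (Some true); inr true; inl (Some (~~ e))]);
             (None, [:: inr true; inl (Some true); inr true; inl (Some e)]
                      ++ tail a)] | e <- [:: false; true]]].

Definition level_cfg (a : int) : cfg bool :=
  @Cfg bool (option bool) None (level_rules a).

Lemma mem_level_rules a e :
  [/\ (Some e, [:: inr false; inl (Some (~~ e))]) \in level_rules a,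
       (Some e, [:: inr true; inl (Some true); inr true; inl (Some (~~ e))])
         \in level_rules a &
       (None, [:: inr true; inl (Some true); inr true; inl (Some e)] ++ tail a)
         \in level_rules a].
Proof. by case: e; rewrite !inE !eqxx !orbT. Qed.

Definition nonterm_lang (a : int) (X : option bool) : language bool :=
  fun w => if X is Some e then level w = 0 /\ parity w = e
           else head true w /\ level w = a.

Section LevelGrammar.

Variable a : int.
Local Notation lang := (@form_lang _ (level_cfg a) (nonterm_lang a)).
Local Notation derives := (@derives _ (level_cfg a)).

Lemma climb_lang k w : lang (climb k) w -> head true w /\ level w = k.
Proof.
elim: k w => [|k IHk] w; first by move=> /= ->.
move=> /form_lang_cat[u [v [-> /IHk[hu lu]]]].
move=> /= [_ -> [z [_ [-> [z0 pz] ->]]]]; rewrite cats0.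
by rewrite level_cat /= z0 parity_cons pz lu /=; split; [case: u hu lu|lia].
Qed.

Lemma tail_lang b w : lang (tail b) w -> head true w /\ level w = b.
Proof.
case: b => k; first exact: climb_lang.
move=> /form_lang_cat[u [v [-> /climb_lang[hu lu]]]].
move=> /= [_ -> [z [_ [-> [z0 pz] ->]]]]; rewrite cats0.
by rewrite level_cat /= z0 parity_cons pz lu /=; split; [case: u hu lu|lia].
Qed.

Lemma level_cfg_sound w :
  cfg_lang (level_cfg a) w -> nonterm_lang a None w.
Proof.
apply: cfg_lang_sound => X u /=; rewrite 2!in_cons => /or3P[].
- by move=> /eqP[-> ->] v /= ->.
- by move=> /eqP[-> ->]; exact: tail_lang.
move=> /flattenP[_ /mapP[e _ ->]]; rewrite !inE => /or3P[] /eqP[-> ->] v /=.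
- move=> [_ -> [z [_ [-> [z0 pz] ->]]]].
  by rewrite cats0 /= z0 parity_cons pz /= negbK.
- move=> [_ -> [u1 [_ [-> [u0 pu] [_ -> [z [_ [-> [z0 pz] ->]]]]]]]].
  rewrite cats0 /= level_cat /= !(parity_cat, parity_cons) u0 z0 pu pz.
  by case: e {pz} => /=; split; lia.
(* The part before [t] has level 0, so it contributes nothing whatever the parity of [t]. *)
- move=> [_ -> [u1 [_ [-> [u0 pu] [_ -> [z [t [-> [z0 pz] /tail_lang[_ ta]]]]]]]]].
  rewrite /= !(level_cat, parity_cat, parity_cons) /= !(level_cat, parity_cat).
  by rewrite u0 z0 pu pz ta; case: e {pz}; case: (parity t) => /=; split; lia.
Qed.

Lemma derives_level0 w :
  level w = 0 -> derives [:: inl (Some (parity w))] [seq inr c | c <- w].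
Proof.
have [m] := ubnP (size w); elim: m w => // m IHm [_ _|[] w lt_wm w0].
- by apply: derives_rule; rewrite !inE.
- have [u [z [wE u0 pu z0]]] := level0_split w0.
  have zw : (size u < m)%N /\ (size z < m)%N.
    by move: lt_wm; rewrite wE /= size_cat /=; lia.
  apply: (derives_rule_trans (G := level_cfg a)
    (u := [:: inr true; inl (Some true); inr true; inl (Some (parity z))])).
    have -> : parity z = ~~ parity (true :: w).
      by rewrite wE parity_cons parity_cat parity_cons pu /= negbK.
    by have [] := mem_level_rules a (parity (true :: w)).
  rewrite wE /= map_cat; apply: derives_cons.
  rewrite -pu -cat1s; apply: derives_cat; first exact: IHm zw.1 u0.
  by apply: derives_cons; exact: IHm zw.2 z0.
- have {}w0 : level w = 0 by move: w0 => /=; lia.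
  apply: (derives_rule_trans (G := level_cfg a)
    (u := [:: inr false; inl (Some (parity w))])).
    have -> : parity w = ~~ parity (false :: w) by rewrite parity_cons negbK.
    by have [] := mem_level_rules a (parity (false :: w)).
  by apply: derives_cons; exact: IHm lt_wm w0.
Qed.

(** [level_split] strips the blocks of [climb k] one at a time from the right, until level 0 is
    left. *)
Lemma derives_climb k w : level w = k%:Z -> exists u t,
  [/\ w = u ++ t, level u = 0 & derives (climb k) [seq inr c | c <- t]].
Proof.
elim: k w => [|k IHk] w lw.
  by exists w, [::]; rewrite cats0; split=> //; exact: rt_refl.
have [|v [z [wE z0 pz lv]]] := @level_split w; first by rewrite lw.
have /IHk[u [t [vE u0 tD]]] : level v = k by rewrite lv lw; lia.
exists u, (t ++ true :: z); rewrite wE vE catA map_cat; split=> //.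
apply: derives_cat tD (derives_cons _ _).
have -> : false = parity z by rewrite pz lw; lia.
exact: derives_level0.
Qed.

Lemma derives_tail b w : level w = b -> exists u t,
  [/\ w = u ++ t, level u = 0 & derives (tail b) [seq inr c | c <- t]].
Proof.
case: b => k lw; first exact: derives_climb.
have [|v [z [wE z0 pz lv]]] := @level_split w; first by rewrite lw.
have /derives_climb[u [t [vE u0 tD]]] : level v = k by rewrite lv lw; lia.
exists u, (t ++ true :: z); rewrite wE vE catA map_cat; split=> //.
apply: derives_cat tD (derives_cons _ _).
have -> : true = parity z by rewrite pz lw.
exact: derives_level0.
Qed.

Lemma level_cfg_complete w : nonterm_lang a None w -> cfg_lang (level_cfg a) w.
Proof.
move=> [hw /derives_tail[u [t [wE u0 tD]]]]; rewrite /cfg_lang wE map_cat.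
(* An empty [u] needs only the production from [None] to [tail a]. Otherwise [u] begins with 1, as
   leading zeros are excluded, and [level0_split] applies. *)
case: u u0 wE => [|b u] u0 wE.
  by apply: derives_rule_trans tD; rewrite !inE eqxx.
have bE : b = true by move: hw; rewrite wE.
rewrite {}bE in u0 *; have [v [z [-> v0 pv z0]]] := level0_split u0.
apply: (derives_rule_trans (G := level_cfg a)
  (u := [:: inr true; inl (Some true); inr true; inl (Some (parity z))] ++ tail a)).
  by have [] := mem_level_rules a (parity z).
apply: derives_cat tD; rewrite /= map_cat; apply: derives_cons.
rewrite -pv -cat1s; apply: derives_cat; first exact: derives_level0.
by apply: derives_cons; exact: derives_level0.
Qed.

End LevelGrammar.

(** * Non-regularity *)

Lemma level_nseq1 n : level (nseq n true) = n.
Proof. by elim: n => //= n ->; rewrite /parity count_nseq /=; lia. Qed.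

Lemma level_reach (a : int) i : exists v,
  parity v = false /\ level (nseq i true ++ v) = a.
Proof.
(* From left to right, the value goes through [i], [-i], [|a|], [-|a|] and [a]. *)
exists (false :: nseq (i + `|a|) true ++ false :: nseq `|a + `|a| | true).
rewrite level_cat parity_cons parity_cat parity_cons /= level_cat parity_cons.
rewrite /= !level_nseq1 /parity !count_nseq /=; split=> //; lia.
Qed.

Theorem theorem2 (a : int) :
  context_free (infser_level a) /\ ~ regular (infser_level a).
Proof.
split.
  exists (level_cfg a) => w; rewrite infser_levelE.
  by split=> [/level_cfg_complete|/level_cfg_sound].
move=> [M M_L].
pose state w := foldl (@dfa_trans _ M) (dfa_start M) w.
(* Pigeonhole on the states. The exponents start at 1 because [v] may begin with 0. *)
have /injectivePn[i [j ij eq_ij]] :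
    ~~ injectiveb (fun i : 'I_#|dfa_state M|.+1 => state (nseq i.+1 true)).
  apply/negP => /injectiveP/leq_card.
  by rewrite card_ord ltnn.
have [v [pv vi]] := level_reach a i.+1.
have /M_L : infser_level a (nseq i.+1 true ++ v).
  by apply/infser_levelE; rewrite vi.
rewrite /dfa_lang foldl_cat [foldl _ _ (nseq _ _)]eq_ij -foldl_cat.
(* As [v] has even parity, the levels of the two words differ by [j - i]. *)
move=> /M_L/infser_levelE[_]; rewrite -vi !level_cat pv !level_nseq1 => ji.
by move: ij ji; rewrite -val_eqE /=; lia.
Qed.
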